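(* Let $m\in\mathbb{N}$, let $E_1,\dots,E_m$ be Banach spaces over $\mathbb{K}$, let $q\in(0,\infty]$ and $\mathbf{r},\mathbf{s},\mathbf{t},\mathbf{u}\in[1,+\infty)^m$. Then each one of the sets $$\mathcal{L}(E_1,\ldots,E_m;\ell_q)\setminus\Pi_{(\mathbf{t},\mathbf{u})}^{\mathrm{ms}}(E_1,\ldots,E_m;\ell_q),\qquad \mathcal{L}(E_1,\ldots,E_m;\ell_q)\setminus\Pi_{(\mathbf{t},\mathbf{u})}^{\mathrm{as}}(E_1,\ldots,E_m;\ell_q)$$ and $$\Pi_{(\mathbf{r},\mathbf{s})}^{\mathrm{as}}(E_1,\ldots,E_m;\ell_q)\setminus\Pi_{(\mathbf{t},\mathbf{u})}^{\mathrm{ms}}(E_1,\ldots,E_m;\ell_q)$$ is either empty or pointwise $\mathfrak{c}$-spaceable (the first two as subsets of $\mathcal{L}(E_1,\ldots,E_m;\ell_q)$, the third as a subset of $\Pi_{(\mathbf{r},\mathbf{s})}^{\mathrm{as}}(E_1,\ldots,E_m;\ell_q)$).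
   Context: $\mathbb{K}$ is $\mathbb{R}$ or $\mathbb{C}$; $\mathfrak{c}=\mathrm{card}\,\mathbb{R}$; $\mathbb{N}=\{1,2,3,\dots\}$. $\ell_q$ is the usual space of scalar sequences with its usual (quasi-)norm. $E'$ is the topological dual of $E$ and $B_{E'}$ its closed unit ball. $\mathcal{L}(E_1,\dots,E_m;F)$ is the space of bounded $m$-linear operators with the sup (quasi-)norm. Mixed norms: for a quasi-Banach space $F$, $\mathbf{r}=(r_1,\dots,r_m)\in[1,\infty)^m$ and $(x_{\mathbf{i}})_{\mathbf{i}\in\mathbb{N}^m}\subset F$, with $\mathbf{i}=(i_1,\dots,i_m)$, $$\|(x_{\mathbf{i}})_{\mathbf{i}\in\mathbb{N}^m}\|_{\ell_{\mathbf{r}}(F)}=\Big(\sum_{i_1=1}^\infty\Big(\cdots\Big(\sum_{i_m=1}^\infty\|x_{\mathbf{i}}\|_F^{r_m}\Big)^{\frac{r_{m-1}}{r_m}}\cdots\Big)^{\frac{r_1}{r_2}}\Big)^{\frac1{r_1}},$$ and for non-empty $\Lambda\subset\mathbb{N}^m$, $\|(x_{\mathbf{i}})_{\mathbf{i}\in\Lambda}\|_{\ell_{\mathbf{r}}(F)}$ is the norm of the multi-matrix that equals $x_{\mathbf{i}}$ on $\Lambda$ and $0$ off $\Lambda$. $\Lambda$-summing operators: an $m$-linear operator $T:E_1\times\cdots\times E_m\to F$ is $\Lambda$-$(\mathbf{r};\mathbf{s})$-summing if there is $C>0$ such that $$\|(Tx_{\mathbf{i}})_{\mathbf{i}\in\Lambda}\|_{\ell_{\mathbf{r}}(F)}\le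 C\prod_{k=1}^m\sup_{\phi_k\in B_{E_k'}}\Big(\sum_{i=1}^N|\phi_k(x_i^{(k)})|^{s_k}\Big)^{1/s_k}$$ for all $N\in\mathbb{N}$ and $x_i^{(k)}\in E_k$, $k=1,\dots,m$, $i=1,\dots,N$, where $Tx_{\mathbf{i}}:=T(x_{i_1}^{(1)},\dots,x_{i_m}^{(m)})$ (with $x_i^{(k)}=0$ for $i>N$). $\Pi^{\Lambda}_{(\mathbf{r},\mathbf{s})}(E_1,\dots,E_m;F)$ is the class of all such operators, a quasi-Banach space under the infimum of the admissible constants $C$. The absolutely summing class $\Pi^{\mathrm{as}}_{(\mathbf{r},\mathbf{s})}$ is the case $\Lambda=\{(n,\dots,n):n\in\mathbb{N}\}$, and the multiple summing class $\Pi^{\mathrm{ms}}_{(\mathbf{r},\mathbf{s})}$ is the case $\Lambda=\mathbb{N}^m$. Pointwise spaceability: for a cardinal $\alpha\le\dim V$, a subset $A$ of a topological vector space $V$ is pointwise $\alpha$-spaceable if for each $x\in A$ there is a closed linear subspace $W\subset V$ with $\dim W=\alpha$ and $x\in W\subset A\cup\{0\}$. *)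

(* Defs.v *)
From HB Require Import structures.
From mathcomp Require Import all_boot all_order all_algebra.
From mathcomp Require Import all_classical all_reals all_analysis.
From mathcomp Require Import complex.

Set Implicit Arguments.
Unset Strict Implicit.
Unset Printing Implicit Defensive.

Import Order.TTheory GRing.Theory Num.Theory.
Import numFieldNormedType.Exports.

Local Open Scope classical_set_scope.
Local Open Scope ring_scope.
Local Open Scope card_scope.

Inductive scalar_kind := RealScalars | ComplexScalars.

Definition scalars (R : realType) (kind : scalar_kind) : numFieldType :=
  match kind with
  | RealScalars => R
  | ComplexScalars => R[i]
  end.

Definition scalar_Re (R : realType) (kind : scalar_kind) :
    scalars R kind -> R :=
  match kind return scalars R kind -> R with
  | RealScalars => id
  | ComplexScalars => @complex.Re R
  end.

(* In a [normedModType K] the norm takes its values in [K] itself; for complex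
   scalars it is a complex number with zero imaginary part. *)
Definition rnorm (R : realType) (kind : scalar_kind)
    (E : normedModType (scalars R kind)) (x : E) : R :=
  scalar_Re `|x|.

Section LinearAlgebra.
Variables (K : numFieldType) (V : lmodType K).
Implicit Types A B W : set V.

Definition linear_subspace W : Prop :=
  W 0 /\ forall (a : K) (u v : V), W u -> W v -> W (a *: u + v).

Definition linearly_independent B : Prop :=
  forall (s : seq V) (c : V -> K), uniq s -> (forall v, v \in s -> B v) ->
    \sum_(v <- s) c v *: v = 0 -> forall v, v \in s -> c v = 0.

Definition linear_span B : set V :=
  [set w | exists (s : seq V) (c : V -> K),
     (forall v, v \in s -> B v) /\ w = \sum_(v <- s) c v *: v].

Definition hamel_basis B W : Prop :=
  linearly_independent B /\ linear_span B = W.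

(* The Hamel dimension of [W] is the cardinality of the set [C]. *)
Definition has_dim W (T : Type) (C : set T) : Prop :=
  exists B : set V, hamel_basis B W /\ B #= C.

Variable R : realType.

(* A quasi-normed space is given by its carrier [X], a linear subspace of [V],
   and a quasi-norm [nu] (only relevant on [X]).  Its topology is the one whose
   open sets are the [U] that contain, with each point, a [nu]-ball around it. *)
Definition quasinorm_open (X : set V) (nu : V -> \bar R) (U : set V) : Prop :=
  U `<=` X /\
  forall x, U x -> exists e : R, 0 < e /\
    forall y, X y -> (nu (y - x)%R < e%:E)%E -> U y.

Definition quasinorm_closed (X : set V) (nu : V -> \bar R) (W : set V) : Prop :=
  W `<=` X /\ quasinorm_open X nu (X `\` W).

(* The cardinal alpha is that of [C].  The side condition alpha <= dim X is
   not repeated: it follows from the existence of [W] as soon as [A] is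
   nonempty. *)
Definition pointwise_spaceable (X : set V) (nu : V -> \bar R)
    (T : Type) (C : set T) (A : set V) : Prop :=
  A `<=` X /\
  forall x, A x -> exists W : set V,
    [/\ linear_subspace W, quasinorm_closed X nu W, has_dim W C, W x &
        W `<=` A `|` [set 0]].

End LinearAlgebra.

Section SequenceSpaces.
Variable R : realType.

(* [q] is in ]0, +oo]; the branch [-oo] is never used. *)
Definition lq_norm (kind : scalar_kind) (q : \bar R)
    (x : nat -> (scalars R kind)^o) : \bar R :=
  match q with
  | r%:E => ((\sum_(0 <= i <oo) (rnorm (x i))%:E `^ r) `^ r^-1)%E
  | +oo%E => ereal_sup [set (rnorm (x i))%:E | i in [set: nat]]
  | -oo%E => +oo%E
  end.

(* Multi-indices are [m.-tuple nat], i.e. the index set {1, 2, ...} is shifted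
   to {0, 1, ...}.  The first component is the outermost summation index.
   The recursion uses S^(r_1 / r_2) = (S^(1 / r_2))^(r_1). *)
Fixpoint mixed_norm (m : nat) :
    m.-tuple R -> (m.-tuple nat -> \bar R) -> \bar R :=
  match m return m.-tuple R -> (m.-tuple nat -> \bar R) -> \bar R with
  | 0 => fun _ a => a [tuple]
  | n.+1 => fun r a =>
      ((\sum_(0 <= i <oo)
          mixed_norm (behead_tuple r) (fun j => a (cons_tuple i j))
            `^ thead r) `^ (thead r)^-1)%E
  end.

End SequenceSpaces.

Section Operators.
Variables (R : realType) (kind : scalar_kind) (m : nat).
Local Notation K := (scalars R kind).
Variable E : 'I_m -> completeNormedModType K.

(* Maps from E_1 x ... x E_m to l_q are represented as maps to the vector space
   of all scalar sequences, with all values of finite l_q quasi-norm. *)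
Definition op_to_seq : lmodType K := ((forall k, E k) -> nat -> K^o).

Implicit Types T : op_to_seq.

Definition multilinear_map T : Prop :=
  forall (k : 'I_m) (x : forall j, E j),
    linear (fun u : E k => T (dfwith x k u) : nat -> K^o).

Definition lq_multilinear (q : \bar R) T : Prop :=
  multilinear_map T /\ forall x, (lq_norm q (T x) < +oo)%E.

Definition op_norm (q : \bar R) T : \bar R :=
  ereal_sup [set lq_norm q (T x) | x in
               [set x : forall k, E k | forall k, rnorm (x k) <= 1]].

Definition bounded_ops (q : \bar R) : set op_to_seq :=
  [set T | lq_multilinear q T /\ (op_norm q T < +oo)%E].

Definition dual_ball (F : normedModType K) : set {linear F -> K^o} :=
  [set phi | continuous phi /\
             forall x : F, rnorm x <= 1 -> rnorm (phi x) <= 1].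

Definition weak_norm (F : normedModType K) (s : R) (N : nat) (x : nat -> F) :
    \bar R :=
  ereal_sup [set ((\sum_(i < N) rnorm (phi (x i)) `^ s) `^ s^-1)%:E
            | phi in @dual_ball F].

Definition summing_const (Lambda : set (m.-tuple nat)) (r s : m.-tuple R)
    (q : \bar R) T (C : R) : Prop :=
  0 < C /\
  forall (N : nat) (x : forall k, nat -> E k), (0 < N)%N ->
    (forall k i, (N <= i)%N -> x k i = 0) ->
    (mixed_norm r (fun i => if i \in Lambda
                            then lq_norm q (T (fun k => x k (tnth i k)))
                            else 0)
     <= C%:E * \prod_(k < m) weak_norm (tnth s k) N (x k))%E.

Definition summing_ops (Lambda : set (m.-tuple nat)) (r s : m.-tuple R)
    (q : \bar R) : set op_to_seq :=
  [set T | lq_multilinear q T /\ exists C, summing_const Lambda r s q T C].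

Definition summing_norm (Lambda : set (m.-tuple nat)) (r s : m.-tuple R)
    (q : \bar R) T : \bar R :=
  ereal_inf [set C%:E | C in summing_const Lambda r s q T].

Definition diagonal_indices : set (m.-tuple nat) :=
  [set nseq_tuple m n | n in [set: nat]].

Definition multiple_summing (r s : m.-tuple R) (q : \bar R) :=
  summing_ops setT r s q.

Definition absolutely_summing (r s : m.-tuple R) (q : \bar R) :=
  summing_ops diagonal_indices r s q.

Definition absolutely_summing_norm (r s : m.-tuple R) (q : \bar R) :=
  summing_norm diagonal_indices r s q.

End Operators.

Arguments bounded_ops {R kind m} E q.
Arguments summing_ops {R kind m} E Lambda r s q.
Arguments multiple_summing {R kind m} E r s q.
Arguments absolutely_summing {R kind m} E r s q.

(* "Pointwise c-spaceable or empty", c being the cardinality of the continuum. *)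
Definition empty_or_spaceable (R : realType) (K : numFieldType)
    (V : lmodType K) (X : set V) (nu : V -> \bar R) (A : set V) : Prop :=
  A = set0 \/ pointwise_spaceable X nu [set: R] A.

(* Main.v *)
Require Import Defs.
From HB Require Import structures.
From mathcomp Require Import all_boot all_order all_algebra.
From mathcomp Require Import all_classical all_reals all_analysis.
From mathcomp Require Import complex ring lra.
Import Order.TTheory GRing.Theory Num.Theory.
Import numFieldNormedType.Exports.
Local Open Scope classical_set_scope.
Local Open Scope ring_scope.

(* Let X be the ambient class of operators and Y the summing class removed
   from it; all that matters is that membership passes to multilinear
   operators whose values are dominated in l_q. Given T in X but not in Y,
   multiplication by the indicator of the even or of the odd coordinates of
   l_q keeps T outside Y, say for the parity class M. The complement of M
   contains infinitely many disjoint infinite sets N_j; let T_j be a copy of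
   T carried by N_j. The space W consists of the members of X of the form c T
   + sum_j a_j T_j. If c <> 0, such an operator lies outside Y because its
   part on M is c times that of T; if c = 0, because its part on N_j is a_j
   T_j. The coefficients are read off from finitely many evaluations, so W is
   closed. The operators sum_j l^j T_j, 0 < l < 1, are linearly independent
   members of W, hence dim W is the continuum. *)

Set Implicit Arguments.
Unset Strict Implicit.
Unset Printing Implicit Defensive.

(** * Quasi-norms of $\ell_p$ type on nonnegative extended real sequences *)

Section LpNorm.
Variable R : realType.
Implicit Types (p : R) (f g : nat -> \bar R).
Local Open Scope ereal_scope.

(** Used for all $p > 0$, hence also as a mere quasi-norm. Both [lq_norm] at a finite exponent and
    every layer of [mixed_norm] unfold to it. *)
Definition Lp p f : \bar R := (\sum_(0 <= i <oo) f i `^ p) `^ p^-1.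

Lemma le_poweR p (a b : \bar R) : (0 <= p)%R -> 0 <= a -> a <= b ->
  a `^ p <= b `^ p.
Proof.
move=> p0 a0 ab; apply: gt0_ler_poweR => //.
  by rewrite in_itv/= a0 leey.
by rewrite in_itv/= (le_trans a0 ab) leey.
Qed.

Lemma poweRK p (a : \bar R) : (p != 0)%R -> 0 <= a -> (a `^ p) `^ p^-1 = a.
Proof. by move=> p0 a0; rewrite -poweRrM divff// poweRe1. Qed.

(** The larger term controls the sum, $a + b \le 2\max(a, b)$, which treats $p < 1$ and $p \ge 1$
    alike. *)
Lemma poweRD_le p (a b : \bar R) : (0 <= p)%R -> 0 <= a -> 0 <= b ->
  (a + b) `^ p <= (2 `^ p)%:E * (a `^ p + b `^ p).
Proof.
move=> p0; wlog ab : a b / a <= b.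
  move=> H a0 b0; case: (leP a b) => ab; first exact: H.
  by rewrite addeC [X in _ * X]addeC; apply: H => //; exact: ltW.
move=> a0 b0; apply: (@le_trans _ _ ((2%:E * b) `^ p)).
  apply: le_poweR => //; first exact: adde_ge0.
  by rewrite mule_natl mule2n leeD2r.
rewrite poweRM// poweR_EFin lee_pmul2l// ?lte_fin ?powR_gt0//.
by rewrite leeDr// poweR_ge0.
Qed.

Lemma Lp_ge0 p f : 0 <= Lp p f.
Proof. exact: poweR_ge0. Qed.

Lemma le_Lp p f g : (0 < p)%R -> (forall i, 0 <= f i) -> (forall i, f i <= g i) ->
  Lp p f <= Lp p g.
Proof.
move=> p0 f0 fg; apply: le_poweR.
- by rewrite invr_ge0 ltW.
- by apply: nneseries_ge0 => *; exact: poweR_ge0.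
apply: lee_nneseries => *; first exact: poweR_ge0.
by apply: le_poweR => //; exact: ltW.
Qed.

Lemma LpZ p (c : R) f : (0 < p)%R -> (0 <= c)%R -> (forall i, 0 <= f i) ->
  Lp p (fun i => c%:E * f i) = c%:E * Lp p f.
Proof.
move=> p0 c0 f0; rewrite /Lp.
under eq_eseriesr do rewrite poweRM// poweR_EFin.
rewrite nneseriesZl; last by move=> *; exact: poweR_ge0.
rewrite poweRM//.
- by rewrite poweR_EFin -powRrM divff ?gt_eqF// powRr1.
- by rewrite lee_fin powR_ge0.
- by apply: nneseries_ge0 => *; exact: poweR_ge0.
Qed.

(** [poweRD_le] is applied twice: termwise with exponent $p$, whose $2^p$ becomes 2 under the root,
    and to the two sums with exponent $1/p$. *)
Definition Lp_const p : R := (2 `^ p^-1 * 2)%R.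

Lemma Lp_const_ge0 p : (0 <= Lp_const p)%R.
Proof. by rewrite mulr_ge0// powR_ge0. Qed.

Lemma LpD p f g : (0 < p)%R -> (forall i, 0 <= f i) -> (forall i, 0 <= g i) ->
  Lp p (fun i => f i + g i) <= (Lp_const p)%:E * (Lp p f + Lp p g).
Proof.
move=> p0 f0 g0.
have p'0 : (0 <= p^-1)%R by rewrite invr_ge0 ltW.
have s0 h : 0 <= \sum_(0 <= i <oo) h i `^ p.
  by apply: nneseries_ge0 => *; exact: poweR_ge0.
apply: (@le_trans _ _ (((2 `^ p)%:E *
    (\sum_(0 <= i <oo) f i `^ p + \sum_(0 <= i <oo) g i `^ p)) `^ p^-1)).
  apply: le_poweR => //; rewrite -nneseriesD; try by move=> *; exact: poweR_ge0.
  rewrite -nneseriesZl; last by move=> *; rewrite adde_ge0// poweR_ge0.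
  apply: lee_nneseries => *; first exact: poweR_ge0.
  by apply: poweRD_le => //; exact: ltW.
rewrite poweRM ?lee_fin ?powR_ge0// ?adde_ge0//.
rewrite poweR_EFin -powRrM divff ?gt_eqF// powRr1//.
rewrite /Lp_const mulrC EFinM -muleA lee_pmul2l//.
exact: poweRD_le.
Qed.

Lemma Lp_ge p f i : (0 < p)%R -> (forall i, 0 <= f i) -> f i <= Lp p f.
Proof.
move=> p0 f0; rewrite -{1}(@poweRK p (f i)) ?gt_eqF//.
apply: le_poweR; [by rewrite invr_ge0 ltW|exact: poweR_ge0|].
rewrite (@nneseriesD1 _ _ i)//; last by move=> *; exact: poweR_ge0.
by rewrite leeDl// nneseries_ge0// => *; exact: poweR_ge0.
Qed.

(** As an unordered sum, the left side runs over the image of [h], a subset of the indices. *)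
Lemma Lp_comp_le p f (h : nat -> nat) : (0 < p)%R -> injective h ->
  (forall i, 0 <= f i) -> Lp p (f \o h) <= Lp p f.
Proof.
move=> p0 hI f0; apply: le_poweR; first by rewrite invr_ge0 ltW.
  by apply: nneseries_ge0 => *; exact: poweR_ge0.
rewrite !nneseries_esumT; try by move=> *; exact: poweR_ge0.
rewrite -(esum_image [set: nat] h (fun j => f j `^ p)); last by move=> ? ? _ _; exact: hI.
by rewrite [X in X <= _]esum_mkcond; apply: le_esum => i _; case: ifP => _//; exact: poweR_ge0.
Qed.

(** Tonelli: [f] is the tensor product of [a] and [g] laid out along [e]. Finiteness of the norm of
    [a] lets it be pulled out of the series as a real factor. *)
Lemma Lp_tensor p f (a g : nat -> R) (e : nat * nat -> nat) : (0 < p)%R ->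
  injective e -> (forall j, 0 <= a j)%R -> (forall k, 0 <= g k)%R ->
  (forall k, f (e k) = (a k.2 * g k.1)%:E) ->
  (forall n, (forall k, e k <> n) -> f n = 0) ->
  Lp p (EFin \o a) < +oo -> Lp p f = Lp p (EFin \o a) * Lp p (EFin \o g).
Proof.
move=> p0 eI a0 g0 fe fn; rewrite /Lp => afin.
have S0 (h : nat -> R) : 0 <= \sum_(0 <= i <oo) (EFin \o h) i `^ p.
  by apply: nneseries_ge0 => *; exact: poweR_ge0.
rewrite -poweRM//; congr (_ `^ _).
have := lty_poweRy _ afin; rewrite invr_eq0 gt_eqF// => /(_ isT).
set A := (X in X < _ -> _ = X * _).
move=> Ay; have A0 : 0 <= A by exact: S0.
rewrite nneseries_esumT; last by move=> *; exact: poweR_ge0.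
rewrite (_ : \esum_(i in _) f i `^ p = \esum_(i in e @` setT) f i `^ p); last first.
  rewrite [RHS]esum_mkcond; apply: eq_esum => n _; case: ifPn => // /negP ne.
  rewrite fn ?poweR0r ?gt_eqF// => k ekn; apply: ne.
  by rewrite inE; exists k.
rewrite esum_image; last by move=> ? ? _ _; exact: eI.
rewrite (_ : [set: nat * nat] = [set: nat] `*`` (fun=> [set: nat])); last first.
  by apply/seteqP; split.
transitivity (\esum_(k in [set: nat] `*`` (fun=> [set: nat]))
    ((g k.1)%:E `^ p * (a k.2)%:E `^ p)).
  by apply: eq_esum => k _; rewrite fe mulrC EFinM poweRM// lee_fin.
rewrite -(@esum_esum _ _ _ setT (fun=> setT)
  (fun i j => (g i)%:E `^ p * (a j)%:E `^ p)); last first.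
  by move=> *; rewrite mule_ge0// poweR_ge0.
transitivity (\esum_(i in [set: nat]) ((EFin \o g) i `^ p * A)).
  apply: eq_esum => i _; rewrite -nneseries_esumT; last first.
    by move=> *; rewrite mule_ge0// poweR_ge0.
  by rewrite poweR_EFin nneseriesZl// => *; exact: poweR_ge0.
rewrite -nneseries_esumT; last by move=> *; rewrite mule_ge0// poweR_ge0.
have : A \is a fin_num by rewrite ge0_fin_numE.
move/fineK => <-.
rewrite -nneseriesZl; last by move=> *; exact: poweR_ge0.
by apply: eq_eseriesr => *; rewrite muleC.
Qed.

(** The $p$-th powers form a geometric series of ratio $l^p < 1$. *)
Lemma Lp_geo p (l : R) : (0 < p)%R -> (0 < l < 1)%R ->
  Lp p (fun j => (l ^+ j)%:E) < +oo.
Proof.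
move=> p0 /andP[l0 l1]; apply: poweR_lty.
have lp0 : (0 < l `^ p)%R by rewrite powR_gt0.
have lp1 : (l `^ p < 1)%R.
  have <- : (1 `^ p = 1 :> R)%R by rewrite powR1.
  by rewrite gt0_ltr_powR// ?nnegrE// ltW.
apply: (@le_lt_trans _ _ ((1 - l `^ p)^-1)%:E); last exact: ltry.
apply: lime_le; first by apply: is_cvg_nneseries => *; exact: poweR_ge0.
apply: nearW => n; rewrite -[X in X%:E]mul1r.
apply: (@le_trans _ _ (series (geometric 1 (l `^ p)%R) n)%:E); last first.
  rewrite lee_fin; apply: geometric_le_lim => //.
  by rewrite ger0_norm// ltW.
rewrite /series/= -sumEFin; apply: lee_sum => i _.
by rewrite lee_fin mul1r -(powR_mulrn i (ltW l0)) -(powR_mulrn i (powR_ge0 _ _)) powRAC.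
Qed.

End LpNorm.

(** * Sets of cardinality at most, or at least, the continuum *)

Section ContinuumCardinality.
Variable R : realType.
Local Open Scope card_scope.

Lemma card_le_inj (T U : Type) (A : set T) (B : set U) (f : T -> U) :
  (forall x, A x -> B (f x)) -> {in A &, injective f} -> A #<= B.
Proof.
move=> AB fI; apply: (@card_le_trans _ _ _ (f @` A)); last first.
  by apply: subset_card_le => _ [x Ax <-]; exact: AB.
by have := inj_card_eq fI; rewrite card_eq_le => /andP[].
Qed.

(* Base 3 rather than 2, so that distinct sequences give distinct numbers. *)
Definition ternary_sum (x : nat -> bool) (n : nat) : R :=
  \sum_(i < n) (x i)%:R / 3 ^+ i.

Definition ternary (x : nat -> bool) : R :=
  sup [set ternary_sum x n | n in [set: nat]].

(** The full tail $\sum_{i \ge n} 3^{-i}$ equals $\frac32 3^{-n}$; subtracting the tail from [n + k]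
    on makes the induction close. *)
Lemma ternary_sum_le x n k :
  ternary_sum x (n + k) <= ternary_sum x n + 3 / 2 / 3 ^+ n - 3 / 2 / 3 ^+ (n + k).
Proof.
elim: k => [|k IH]; first by rewrite addn0 addrK.
rewrite addnS /ternary_sum big_ord_recr/= -/(ternary_sum x (n + k)).
have -> : 3 / 2 / 3 ^+ (n + k).+1 = (2^-1 : R) / 3 ^+ (n + k).
  rewrite exprS; field; by rewrite expf_neq0.
have : (x (n + k)%N)%:R / 3 ^+ (n + k) <= (3 ^+ (n + k))^-1 :> R.
  by rewrite ler_piMl// lern1 leq_b1.
rewrite -/(ternary_sum x n); nra.
Qed.

(** At the first index $n$ where two sequences differ, the digit 1 contributes $3^{-n}$, while all
    later digits together contribute at most $\frac12 3^{-n}$. *)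
Lemma ternary_inj : injective ternary.
Proof.
have nd x n k : ternary_sum x n <= ternary_sum x (n + k).
  elim: k => [|k IH]; first by rewrite addn0.
  rewrite addnS /ternary_sum big_ord_recr/= (le_trans IH)// lerDl.
  by rewrite mulr_ge0.
have ub x n : ubound [set ternary_sum x n | n in [set: nat]]
    (ternary_sum x n + 3 / 2 / 3 ^+ n).
  move=> _ [j _ <-]; apply: (@le_trans _ _ (ternary_sum x (n + j))).
    by rewrite addnC.
  by apply: (le_trans (ternary_sum_le _ _ _)); rewrite gerBl.
have lt x y n : (forall i, (i < n)%N -> x i = y i) -> x n = true -> y n = false ->
    ternary y < ternary x.
  move=> xy xn yn.
  have y_le : ternary y <= ternary_sum y n.+1 + 3 / 2 / 3 ^+ n.+1.
    apply: ge_sup; last exact: ub.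
    by exists (ternary_sum y 0); exists 0%N.
  have x_ge : ternary_sum x n.+1 <= ternary x.
    apply: ub_le_sup; last by exists n.+1.
    by exists (ternary_sum x 0 + 3 / 2 / 3 ^+ 0); exact: ub.
  apply: (le_lt_trans y_le); apply: lt_le_trans x_ge.
  rewrite /ternary_sum !big_ord_recr/= xn yn mul0r addr0 mul1r.
  rewrite (eq_bigr (fun i : 'I_n => (x i)%:R / 3 ^+ i)); last by move=> i _; rewrite xy.
  rewrite -?addrA ?addr0 ltrD2l exprS. 
  have : 0 < (3 ^+ n)^-1 :> R by rewrite invr_gt0 exprn_gt0.
  by rewrite invfM; lra.
move=> x y fxy; apply/funext => n; elim/ltn_ind: n => n IH.
case xn: (x n); case yn: (y n) => //.
  by have := lt _ _ _ IH xn yn; rewrite fxy ltxx.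
have := lt y x n _ yn xn; rewrite fxy ltxx => F.
by suff : false by []; apply: F => i /IH.
Qed.

Lemma card_fun_bool (I : countType) : [set: I -> bool] #<= [set: R].
Proof.
apply: (@card_le_inj _ _ _ _
  (fun h => ternary (fun n => if unpickle n is Some i then h i else false))) => //.
move=> h1 h2 _ _ /ternary_inj h12; apply/funext => i.
by have := congr1 (fun h => h (pickle i)) h12; rewrite pickleK.
Qed.

Lemma rat_cut_inj (x y : R) :
  (forall c : rat, (ratr c < x) = (ratr c < y)) -> x = y.
Proof.
move=> xy; apply/eqP; rewrite eq_le.
suff H (a b : R) : (forall c : rat, (ratr c < a) = (ratr c < b)) -> a <= b.
  by rewrite !H// => c; rewrite xy.
move=> ab; rewrite leNgt; apply/negP => /rat_in_itvoo[c].
by rewrite in_itv/= ab => /andP[/lt_trans/[apply]]; rewrite ltxx.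
Qed.

(** A real is coded by its rational cut and a complex number by two cuts, the boolean choosing the
    real or the imaginary part. *)
Lemma scalars_code (kind : scalar_kind) : exists f : scalars R kind -> bool * rat -> bool,
  injective f.
Proof.
case: kind => /=.
  exists (fun x bc => ratr bc.2 < x) => x y xy; apply: rat_cut_inj => c.
  exact: (congr1 (fun h => h (true, c)) xy).
exists (fun x bc => ratr bc.2 < if bc.1 then complex.Re x else complex.Im x).
move=> [a b] [c d] xy; congr (_ +i* _)%C; apply: rat_cut_inj => e.
  exact: (congr1 (fun h => h (true, e)) xy).
exact: (congr1 (fun h => h (false, e)) xy).
Qed.

(** Coding each value by countably many bits turns a countable family of scalars into one family of
    bits, again countably indexed. *)
Lemma card_scalar_fun (kind : scalar_kind) (I : countType) :
  [set: I -> scalars R kind] #<= [set: R].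
Proof.
have [f fI] := scalars_code kind.
apply: card_le_trans (card_fun_bool (I * (bool * rat))%type).
apply: (@card_le_inj _ _ _ _ (fun h ic => f (h ic.1) ic.2)) => //.
move=> h1 h2 _ _ h12; apply/funext => i; apply: fI; apply/funext => c.
exact: (congr1 (fun h => h (i, c)) h12).
Qed.

Lemma card_itv01 : [set: R] #<= [set l : R | 0 < l < 1].
Proof.
apply: (@card_le_inj _ _ _ _ (fun x => (1 + expR x)^-1)) => [x _ /=|x y _ _ /=].
  have e0 := expR_gt0 x.
  by rewrite invr_gt0 invf_lt1 ?ltrDl// ?addr_gt0.
by move/invr_inj/addrI/expR_inj.
Qed.

End ContinuumCardinality.

(** * Extension of independent sets to Hamel bases *)

Section HamelBasis.
Variables (K : numFieldType) (V : lmodType K).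
Implicit Types A B W : set V.

Lemma linear_subspace_sum W (s : seq V) (c : V -> K) : linear_subspace W ->
  (forall v, v \in s -> W v) -> W (\sum_(v <- s) c v *: v).
Proof.
move=> [W0 WD]; elim: s => [|v s IH] sW; first by rewrite big_nil.
rewrite big_cons; apply: WD; first by apply: sW; rewrite mem_head.
by apply: IH => w ws; apply: sW; rewrite inE ws orbT.
Qed.

Lemma linearly_independentU1 B w : linearly_independent B -> ~ linear_span B w ->
  linearly_independent (B `|` [set w]).
Proof.
move=> Bi wB s c us sB s0 v vs.
have [ws|ws] := boolP (w \in s); last first.
  apply: (Bi s) => // x xs; case: (sB _ xs) => // /= xw.
  by move: ws; rewrite -xw xs.
have rB x : x \in rem w s -> B x.
  rewrite mem_rem_uniq// !inE => /andP[/eqP xw xs].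
  by case: (sB _ xs).
have := s0; rewrite (perm_big _ (perm_to_rem ws)) big_cons /= => s0'.
have cw : c w = 0.
  apply: contrapT => /eqP cw; apply: wB.
  exists (rem w s), (fun x => - (c w)^-1 * c x); split => //.
  rewrite (eq_bigr (fun x => (- (c w)^-1) *: (c x *: x))); last by move=> *; rewrite scalerA.
  rewrite -scaler_sumr; move/eqP: s0'; rewrite addrC addr_eq0 => /eqP ->.
  by rewrite scalerN scaleNr opprK scalerA mulVf// scale1r.
have [->//|vw] := eqVneq v w.
apply: (Bi (rem w s)) => //; first exact: rem_uniq.
  by move: s0'; rewrite cw scale0r add0r.
by rewrite mem_rem_uniq// !inE vw.
Qed.

(** Zorn's lemma runs over the sets [B] whose union with [A] is independent, rather than over
    supersets of [A], so that the union of the empty chain qualifies. *)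
Lemma hamel_basis_extension A W : linear_subspace W -> A `<=` W ->
  linearly_independent A -> exists B, A `<=` B /\ hamel_basis B W.
Proof.
move=> Wl AW Ai.
pose P B := B `<=` W /\ linearly_independent (B `|` A).
have [F FP Ft|B [[BW Bi] Bmax]] := @Zorn_bigcup V P.
  split; first by move=> x [X /FP[XW _]] /XW.
  move=> s c us sF s0 v vs.
  have [F0|/set0P[X0 FX0]] := eqVneq F set0.
    apply: (Ai s) => // x /sF[[X]|//].
    by rewrite F0.
  (* A linear relation involves finitely many vectors, so a single member of the chain, together
     with [A], contains all of them. *)
  suff [X FX sX] : exists2 X, F X & forall x, x \in s -> (X `|` A) x.
    by apply: ((FP _ FX).2 s).
  elim: s {us s0 vs} sF => [|x s IH] sF; first by exists X0.
  have [X FX sX] : exists2 X, F X & forall x, x \in s -> (X `|` A) x.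
    by apply: IH => y ys; apply: sF; rewrite inE ys orbT.
  have [[Y FY Yx]|Ax] := sF x (mem_head _ _); last first.
    by exists X => // y; rewrite inE => /orP[/eqP ->|/sX//]; right.
  have [XY|YX] := Ft _ _ FX FY.
    exists Y => // y; rewrite inE => /orP[/eqP ->|/sX[/XY|]]; by [left|right].
  by exists X => // y; rewrite inE => /orP[/eqP ->|/sX//]; left; exact: YX.
exists (B `|` A); split; first by move=> x; right.
split => //; apply/seteqP; split.
  move=> _ [s [c [sB ->]]]; apply: linear_subspace_sum => // v /sB[/BW//|/AW//].
move=> w Ww; apply: contrapT => wB.
apply: (Bmax (B `|` [set w])).
  split; first by move=> x; left.
  move=> /(_ w (or_intror erefl)) Bw; apply: wB.
  exists [:: w], (fun=> 1); split; last by rewrite big_seq1 scale1r.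
  by move=> x; rewrite inE => /eqP ->; left.
split; first by move=> x [/BW//|->].
by rewrite setUAC; exact: linearly_independentU1.
Qed.

End HamelBasis.

(** * Real-valued norms over both scalar fields *)

Section ScalarNorm.
Variables (R : realType) (kind : scalar_kind).
Local Notation K := (scalars R kind).

Lemma scalar_ReD (a b : K) : scalar_Re (a + b) = scalar_Re a + scalar_Re b.
Proof. by case: kind a b => //= -[? ?] [? ?]. Qed.

Lemma scalar_ReM (a b : K) : 0 <= a -> 0 <= b ->
  scalar_Re (a * b) = scalar_Re a * scalar_Re b.
Proof.
case: kind a b => //= -[a a'] [b b'].
by rewrite !lecE/= => /andP[/eqP-> _] /andP[/eqP-> _]; rewrite mulr0 subr0.
Qed.

Lemma scalar_Re_le (a b : K) : a <= b -> scalar_Re a <= scalar_Re b.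
Proof. by case: kind a b => //= -[a a'] [b b']; rewrite lecE/= => /andP[]. Qed.

Lemma scalar_Re0 : scalar_Re (0 : K) = 0.
Proof. by case: kind. Qed.

Lemma scalar_Re1 : scalar_Re (1 : K) = 1.
Proof. by case: kind. Qed.

Lemma scalar_Re_eq0 (a : K) : 0 <= a -> scalar_Re a = 0 -> a = 0.
Proof.
case: kind a => //= -[a a']; rewrite lecE/= => /andP[/eqP-> _] ->//.
Qed.

Section Module.
Variable E : normedModType K.
Implicit Types (x y : E) (c : K).

Lemma rnorm_ge0 x : 0 <= rnorm x.
Proof. by rewrite -[X in X <= _]scalar_Re0; apply: scalar_Re_le. Qed.

Lemma rnormD x y : rnorm (x + y) <= rnorm x + rnorm y.
Proof. by rewrite /rnorm -scalar_ReD; apply: scalar_Re_le; exact: ler_normD. Qed.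

Lemma rnormZ c x : rnorm (c *: x) = rnorm (c : K^o) * rnorm x.
Proof. by rewrite /rnorm normrZ scalar_ReM. Qed.

Lemma rnorm0 : rnorm (0 : E) = 0.
Proof. by rewrite /rnorm normr0 scalar_Re0. Qed.

Lemma rnorm_eq0 x : rnorm x = 0 -> x = 0.
Proof. by move=> /(scalar_Re_eq0 (normr_ge0 x))/normr0_eq0. Qed.

(** Dividing by the norm plus 1 makes the case of a zero vector no exception. *)
Lemma exists_rescaling x : exists c : K, c != 0 /\ rnorm (c^-1 *: x) <= 1.
Proof.
have c0 : 0 < `|x| + 1 by rewrite ltr_wpDl.
exists (`|x| + 1); split; first by rewrite gt_eqF.
rewrite /rnorm normrZ -scalar_Re1; apply: scalar_Re_le.
by rewrite normfV (gtr0_norm c0) ler_pdivrMl// mulr1 lerDl.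
Qed.

End Module.

Lemma rnormM (a b : K) : rnorm (a * b : K^o) = rnorm (a : K^o) * rnorm (b : K^o).
Proof. exact: rnormZ. Qed.

Lemma rnorm1 : rnorm (1 : K^o) = 1.
Proof. by rewrite /rnorm normr1 scalar_Re1. Qed.

Lemma rnormX (a : K) n : rnorm (a ^+ n : K^o) = rnorm (a : K^o) ^+ n.
Proof.
by elim: n => [|n IH]; rewrite ?expr0 ?rnorm1// !exprS rnormM IH.
Qed.

Definition real_scalar : R -> K :=
  match kind return R -> scalars R kind with
  | RealScalars => id
  | ComplexScalars => fun x => (x%:C)%C
  end.

Lemma real_scalar_inj : injective real_scalar.
Proof. by rewrite /real_scalar; case: kind => // x y []. Qed.

Lemma rnorm_real_scalar x : 0 <= x -> rnorm (real_scalar x : K^o) = x.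
Proof.
rewrite /real_scalar /rnorm; case: kind => /= x0; first exact: ger0_norm.
have xE : `|(x%:C)%C : R[i]| = (x%:C)%C by apply: ger0_norm; rewrite lecE/= eqxx.
exact: (congr1 (@complex.Re R) xE).
Qed.

End ScalarNorm.

(** * The quasi-norm of $\ell_q$ *)

Section LqNorm.
Variables (R : realType) (kind : scalar_kind) (q : \bar R).
Hypothesis q0 : (0 < q)%E.
Local Notation K := (scalars R kind).
Implicit Types x y : nat -> K^o.
Local Open Scope ereal_scope.

Let rE0 x i : 0 <= (rnorm (x i))%:E.
Proof. by rewrite lee_fin rnorm_ge0. Qed.

Lemma lq_norm_fin (p : R) x : lq_norm p%:E x = Lp p (fun i => (rnorm (x i))%:E).
Proof. by []. Qed.

Lemma lq_norm_ge0 x : 0 <= lq_norm q x.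
Proof.
case: q q0 => [p p0|_|//]; first exact: Lp_ge0.
by apply: (le_trans (rE0 x 0)); apply: ereal_sup_ubound; exists 0%N.
Qed.

Lemma lq_norm_ge x i : (rnorm (x i))%:E <= lq_norm q x.
Proof.
case: q q0 => [p p0|_|//].
  by rewrite lq_norm_fin; apply: (Lp_ge i p0).
by apply: ereal_sup_ubound; exists i.
Qed.

Lemma le_lq_norm x y : (forall i, rnorm (x i) <= rnorm (y i))%R ->
  lq_norm q x <= lq_norm q y.
Proof.
move=> xy; case: q q0 => [p p0|_|//].
  by rewrite !lq_norm_fin; apply: le_Lp.
apply: ge_ereal_sup => _ [i _ <-]; apply: le_trans (_ : (rnorm (y i))%:E <= _).
  by rewrite lee_fin.
by apply: ereal_sup_ubound; exists i.
Qed.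

Lemma lq_normZ (c : K) x :
  lq_norm q (c *: (x : nat -> K^o)) <= (rnorm (c : K^o))%:E * lq_norm q x.
Proof.
move: (lq_norm_ge x); case: q q0 => [p p0 _|_ le|//].
  rewrite !lq_norm_fin -LpZ ?rnorm_ge0//.
  by apply: le_Lp => // i; rewrite -EFinM -rnormM.
apply: ge_ereal_sup => _ [i _ <-]; rewrite rnormM EFinM.
by apply: lee_pmul => //; rewrite lee_fin rnorm_ge0.
Qed.

Definition lq_const : R := if q is p%:E then Lp_const p else 1.

Lemma lq_const_ge0 : (0 <= lq_const)%R.
Proof. by rewrite /lq_const; case: q => *; rewrite ?ler01// Lp_const_ge0. Qed.

Lemma lq_normD x y :
  lq_norm q (x + y)%R <= lq_const%:E * (lq_norm q x + lq_norm q y).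
Proof.
move: (lq_norm_ge x) (lq_norm_ge y); rewrite /lq_const.
case: q q0 => [p p0 _ _|_ lex ley|//].
  rewrite !lq_norm_fin; apply: le_trans (LpD _ _ _) => //.
  by apply: le_Lp => // i; rewrite -EFinD lee_fin rnormD.
apply: ge_ereal_sup => _ [i _ <-]; rewrite mul1e.
apply: le_trans (leeD (lex i) (ley i)).
by rewrite -EFinD lee_fin rnormD.
Qed.

(** This allows one copy of a sequence to be read off a longer sequence that carries many copies. *)
Lemma lq_norm_comp_le x (h : nat -> nat) : injective h ->
  lq_norm q (x \o h) <= lq_norm q x.
Proof.
move: (lq_norm_ge x)=> + hI.
case: q q0 => [p p0 _|_ le|//].
  exact: (@Lp_comp_le _ p _ h).
by apply: ge_ereal_sup => _ [i _ <-] /=.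
Qed.

End LqNorm.

(** * Weighted disjoint copies of a sequence *)

Section Spread.
Variables (R : realType) (kind : scalar_kind).
Local Notation K := (scalars R kind).
Implicit Types (x : nat -> K^o) (a : nat -> K) (b : bool).

(** All codes have parity [b]; for fixed [j], the codes of the pairs [(k, j)] form the set $N_j$. *)
Definition pair_code b (kj : nat * nat) : nat := b + (pickle kj).*2.

(** This is $\sum_j a_j x_j$, where $x_j$ is the copy of $x$ carried by $N_j$. The supports are
    disjoint, so no convergence is involved. *)
Definition spread b a x : nat -> K^o := fun n =>
  if odd n == b then
    if @pickle_inv (nat * nat)%type n./2 is Some kj then a kj.2 * x kj.1 else 0
  else 0.

Lemma odd_pair_code b kj : odd (pair_code b kj) = b.
Proof. by rewrite /pair_code oddD odd_double addbF; case: b. Qed.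

Lemma spread_pair_code b a x kj : spread b a x (pair_code b kj) = a kj.2 * x kj.1.
Proof. by rewrite /spread odd_pair_code eqxx half_bit_double pickleK_inv. Qed.

Lemma spread_out b a x n : (forall kj, pair_code b kj <> n) -> spread b a x n = 0.
Proof.
move=> ne; rewrite /spread; case: eqP => // on.
have := @pickle_invK (nat * nat)%type n./2; case: pickle_inv => //= kj kjn.
by case: (ne kj); rewrite /pair_code kjn -on odd_double_half.
Qed.

Lemma pair_code_inj b : injective (pair_code b).
Proof.
by move=> k l /addnI/double_inj; exact: (pcan_inj pickleK_inv).
Qed.

Lemma spread_odd b a x n : odd n != b -> spread b a x n = 0.
Proof. by rewrite /spread => /negbTE ->. Qed.

Lemma spread_linear b a (c : K) x y :
  spread b a (c *: (x : nat -> K^o) + y) = c *: (spread b a x : nat -> K^o) + spread b a y.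
Proof.
apply/funext => n; rewrite /spread !fctE.
case: ifP => _; last by rewrite scaler0 addr0.
case: pickle_inv => [kj|]; last by rewrite scaler0 addr0.
rewrite /GRing.scale/= mulrDr; congr (_ + _); ring.
Qed.

Lemma spread_linearl b a a' (c : K) x :
  spread b (fun j => c * a j + a' j) x = c *: (spread b a x : nat -> K^o) + spread b a' x.
Proof.
apply/funext => n; rewrite /spread !fctE.
case: ifP => _; last by rewrite scaler0 addr0.
case: pickle_inv => [kj|]; last by rewrite scaler0 addr0.
by rewrite mulrDl -mulrA.
Qed.

(** For finite [q] the quasi-norm of the spread factors as that of the weights times that of [x],
    and geometric weights have finite quasi-norm. For infinite [q] the weights are at most 1 in
    modulus. *)
Lemma lq_norm_spread (q : \bar R) b (z : K) : (0 < q)%E ->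
  0 < rnorm (z : K^o) < 1 ->
  exists C : R, 0 <= C /\ forall x,
    (lq_norm q (spread b (fun j => (z ^+ j)%R) x) <= C%:E * lq_norm q x)%E.
Proof.
move=> q0 z01; case: q q0 => [p p0| _ |//]; last first.
  exists 1; split => // x; rewrite mul1e.
  apply: ge_ereal_sup => _ [n _ <-].
  have [[kj <-]|ne] := pselect (exists kj, pair_code b kj = n); last first.
    rewrite spread_out; last by move=> kj kjn; apply: ne; exists kj.
    by rewrite rnorm0; exact: (@lq_norm_ge0 _ _ +oo%E).
  rewrite spread_pair_code; apply: le_trans (lq_norm_ge _ x kj.1); last by [].
  rewrite lee_fin rnormM ler_piMl ?rnorm_ge0// rnormX exprn_ile1 ?rnorm_ge0//.
  by case/andP: z01 => _ /ltW.
rewrite lte_fin in p0.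
have geo := Lp_geo p0 z01.
exists (fine (Lp p (fun j => (rnorm (z : K^o) ^+ j)%:E))); split.
  by apply: fine_ge0; exact: Lp_ge0.
move=> x; rewrite fineK; last by rewrite ge0_fin_numE// Lp_ge0.
rewrite !lq_norm_fin.
rewrite (@Lp_tensor _ p _ (fun j => rnorm (z : K^o) ^+ j) (fun k => rnorm (x k))
  (pair_code b))//.
- exact: pair_code_inj.
- by move=> j; rewrite exprn_ge0// rnorm_ge0.
- by move=> k; exact: rnorm_ge0.
- by move=> kj; rewrite spread_pair_code rnormM rnormX.
- by move=> n ne; rewrite spread_out// rnorm0.
Qed.

End Spread.

(** * Monotonicity, homogeneity and the quasi-triangle inequality for mixed norms *)

Section MixedNorm.
Variable R : realType.
Local Open Scope ereal_scope.

Lemma mixed_normS m (r : m.+1.-tuple R) (f : m.+1.-tuple nat -> \bar R) :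
  mixed_norm r f =
  Lp (thead r) (fun i => mixed_norm (behead_tuple r) (fun j => f (cons_tuple i j))).
Proof. by []. Qed.

Section Step.
Variables (m : nat) (r : m.+1.-tuple R).
Hypothesis r0 : forall k, (0 < tnth r k)%R.

Lemma thead_gt0 : (0 < thead r)%R. Proof. exact: r0. Qed.

Lemma behead_tuple_gt0 k : (0 < tnth (behead_tuple r) k)%R.
Proof. by rewrite tnth_behead. Qed.

End Step.

Lemma mixed_norm_ge0 m (r : m.-tuple R) f : (forall i, 0 <= f i) ->
  0 <= mixed_norm r f.
Proof. by case: m r f => [|m] r f f0; [exact: f0|rewrite mixed_normS Lp_ge0]. Qed.

Lemma le_mixed_norm m (r : m.-tuple R) f g : (forall k, (0 < tnth r k)%R) ->
  (forall i, 0 <= f i) -> (forall i, f i <= g i) ->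
  mixed_norm r f <= mixed_norm r g.
Proof.
elim: m r f g => [|m IH] r f g r0 f0 fg; first exact: fg.
rewrite !mixed_normS; apply: le_Lp => [|i|i].
- exact: thead_gt0.
- exact: mixed_norm_ge0.
by apply: IH => //; exact: behead_tuple_gt0.
Qed.

Lemma mixed_normZ m (r : m.-tuple R) (c : R) f : (forall k, (0 < tnth r k)%R) ->
  (0 <= c)%R -> (forall i, 0 <= f i) ->
  mixed_norm r (fun i => c%:E * f i) = c%:E * mixed_norm r f.
Proof.
move=> + c0; elim: m r f => [|m IH] r f r0 f0//.
rewrite !mixed_normS -LpZ//; [|exact: thead_gt0|by move=> i; exact: mixed_norm_ge0].
by congr Lp; apply/funext => i; rewrite IH//; exact: behead_tuple_gt0.
Qed.

(** Each summation layer contributes one factor [Lp_const]. *)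
Lemma mixed_normD m (r : m.-tuple R) : (forall k, (0 < tnth r k)%R) ->
  exists C : R, (0 <= C)%R /\ forall f g, (forall i, 0 <= f i) -> (forall i, 0 <= g i) ->
  mixed_norm r (fun i => f i + g i) <= C%:E * (mixed_norm r f + mixed_norm r g).
Proof.
elim: m r => [|m IH] r r0.
  by exists 1%R; split => // f g _ _; rewrite mul1e.
have [C [C0 HC]] := IH _ (behead_tuple_gt0 r0).
have p0 := thead_gt0 r0.
exists (C * Lp_const (thead r))%R; split; first by rewrite mulr_ge0// Lp_const_ge0.
move=> f g f0 g0; rewrite !mixed_normS.
apply: (@le_trans _ _ (Lp (thead r) (fun i => C%:E *
  (mixed_norm (behead_tuple r) (fun j => f (cons_tuple i j)) +
   mixed_norm (behead_tuple r) (fun j => g (cons_tuple i j)))))).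
  apply: le_Lp => // i; last exact: HC.
  by apply: mixed_norm_ge0 => j; exact: adde_ge0.
rewrite LpZ//; last by move=> i; rewrite adde_ge0// mixed_norm_ge0.
rewrite EFinM -muleA; apply: lee_wpmul2l; first by rewrite lee_fin.
by apply: LpD => // i; exact: mixed_norm_ge0.
Qed.

Lemma mixed_norm_ge m (r : m.-tuple R) f i : (forall k, (0 < tnth r k)%R) ->
  (forall i, 0 <= f i) -> f i <= mixed_norm r f.
Proof.
elim: m r f i => [|m IH] r f i r0 f0; first by rewrite (tuple0 i).
have [j [k ->]] : exists j k, i = cons_tuple j k.
  by exists (thead i), (behead_tuple i); rewrite {1}(tuple_eta i).
rewrite mixed_normS; apply: le_trans; last first.
  apply: (@Lp_ge _ _ _ j); first exact: thead_gt0.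
  by move=> l; exact: mixed_norm_ge0.
by apply: (IH _ (fun k => f (cons_tuple j k))) => //; exact: behead_tuple_gt0.
Qed.

End MixedNorm.

(** * Classes of multilinear operators stable under domination *)

Section OperatorIdeals.
Variables (R : realType) (kind : scalar_kind) (m : nat).
Local Notation K := (scalars R kind).
Variables (E : 'I_m -> completeNormedModType K) (q : \bar R).
Hypothesis q0 : (0 < q)%E.
Local Notation V := (op_to_seq E).
Implicit Types (S T : V) (X Y : set V).

Lemma multilinear0 : multilinear_map (0 : V).
Proof. by move=> k x a u v; rewrite /= scaler0 addr0. Qed.

Lemma multilinear_comb (a : K) S T :
  multilinear_map S -> multilinear_map T -> multilinear_map (a *: S + T : V).
Proof.
move=> Sl Tl k x c u v.
have SE := Sl k x c u v; have TE := Tl k x c u v; rewrite /= in SE TE.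
change (a *: S (dfwith x k (c *: u + v)) + T (dfwith x k (c *: u + v)) =
  c *: (a *: S (dfwith x k u) + T (dfwith x k u)) +
  (a *: S (dfwith x k v) + T (dfwith x k v)) :> (nat -> K^o)).
by rewrite SE TE !scalerDr !scalerA mulrC -!addrA; congr (_ + _); rewrite addrCA.
Qed.

Lemma multilinear_comp (g : (nat -> K^o) -> nat -> K^o) T :
  (forall c x y, g (c *: x + y) = c *: g x + g y) ->
  multilinear_map T -> multilinear_map (fun x => g (T x)).
Proof. by move=> gl Tl k x c u v; rewrite /= (Tl k x c u v) gl. Qed.

Lemma multilinearZ T k (x : forall j, E j) (c : K) (u : E k) : multilinear_map T ->
  T (dfwith x k (c *: u)) = c *: (T (dfwith x k u) : nat -> K^o).
Proof.
(* Linearity with coefficient $-1$ at two zero vectors gives $T(0) = -T(0) + T(0)$. *)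
move=> Tl; have T0 : T (dfwith x k 0) = 0.
  have := Tl k x (-1) 0 0; rewrite /= scaler0 addr0 => ->.
  by rewrite scaleN1r addNr.
by have := Tl k x c u 0; rewrite /= addr0 T0 addr0.
Qed.

(** The coordinates are rescaled one at a time. As [d] and [y] do not depend on [T], the operator
    norm controls the evaluation at [x] uniformly in [T]. *)
Lemma exists_unit_rescaling (x : forall k, E k) :
  exists (d : K) (y : forall k, E k), (forall k, rnorm (y k) <= 1) /\
    forall T, multilinear_map T -> T x = d *: (T y : nat -> K^o).
Proof.
suff [d [y [y1 Ty]]] : exists (d : K) (y : forall k, E k),
    (forall k, k \in enum 'I_m -> rnorm (y k) <= 1) /\
    forall T, multilinear_map T -> T x = d *: (T y : nat -> K^o).
  by exists d, y; split => // k; apply: y1; rewrite mem_enum.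
elim: (enum 'I_m) => [|k s [d [y [y1 Ty]]]].
  by exists 1, x; split => // T _; rewrite scale1r.
have [c [c0 c1]] := exists_rescaling (y k).
exists (d * c), (dfwith y k (c^-1 *: y k)); split.
  move=> j; have [->|jk] := eqVneq j k; first by rewrite dfwithin.
  by rewrite inE (negbTE jk)/= dfwithout ?(eq_sym k)//; exact: y1.
move=> T Tl; rewrite Ty// -scalerA -multilinearZ// scalerA mulfV// scale1r.
congr (_ *: T _); apply: functional_extensionality_dep => j.
by have [<-|jk] := eqVneq k j; rewrite ?dfwithin// dfwithout.
Qed.

(** Domination by two members at once covers sums, scalar multiples and restriction of coordinates
    in a single axiom, with no appeal to how the class is defined. *)
Definition operator_ideal X : Prop :=
  [/\ X 0, forall T, X T -> multilinear_map T &
      forall S T1 T2 (c : R), 0 <= c -> multilinear_map S -> X T1 -> X T2 ->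
        (forall x, lq_norm q (S x) <= c%:E * (lq_norm q (T1 x) + lq_norm q (T2 x)))%E ->
        X S].

(** Continuity of every evaluation $T \mapsto T(x)_n$. The strict bound by [e] suits a quasi-norm
    defined as an infimum: it yields an admissible constant below [e]. *)
Definition bounded_evaluations (nu : V -> \bar R) : Prop :=
  forall x n, exists D : R, 0 <= D /\
    forall T (e : R), multilinear_map T -> (nu T < e%:E)%E -> rnorm (T x n) <= D * e.

Lemma operator_ideal_dominated X S T (c : R) : operator_ideal X -> 0 <= c ->
  multilinear_map S -> X T ->
  (forall x, lq_norm q (S x) <= c%:E * lq_norm q (T x))%E -> X S.
Proof.
move=> [_ _ XX] c0 Sl XT ST; apply: (XX S T T c) => // x.
apply: (le_trans (ST x)); apply: lee_wpmul2l; first by rewrite lee_fin.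
by rewrite leeDl// lq_norm_ge0.
Qed.

Lemma operator_ideal_subspace X : operator_ideal X -> linear_subspace X.
Proof.
move=> [X0 Xl XX]; split => // a S T XS XT.
(* One constant has to serve both summands: $|a|$ for [S] and 1 for [T]. *)
apply: (XX _ S T (lq_const q * Num.max (rnorm (a : K^o)) 1)) => //.
- by rewrite mulr_ge0// ?lq_const_ge0// le_max ler01 orbT.
- by apply: multilinear_comb; exact: Xl.
move=> x; apply: (le_trans (lq_normD q0 _ _)).
rewrite EFinM -muleA; apply: lee_wpmul2l; first by rewrite lee_fin lq_const_ge0.
rewrite ge0_muleDr ?lq_norm_ge0//; apply: leeD.
  apply: (le_trans (lq_normZ q0 _ _)); apply: lee_wpmul2r; first exact: lq_norm_ge0.
  by rewrite lee_fin le_max lexx.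
by rewrite lee_pemull ?lq_norm_ge0// lee_fin le_max lexx orbT.
Qed.

Lemma lq_norm0 : lq_norm q (0 : nat -> K^o) = 0%E.
Proof.
apply/eqP; rewrite eq_le lq_norm_ge0// andbT.
have := lq_normZ q0 (0 : K) (0 : nat -> K^o).
by rewrite scale0r rnorm0 mul0e.
Qed.

Lemma bounded_ops_ideal : operator_ideal (bounded_ops E q).
Proof.
split.
- split; last first.
    apply: le_lt_trans (ltry 0); apply: ge_ereal_sup => _ [x _ <-].
    by rewrite lq_norm0.
  by split; [exact: multilinear0|move=> x; rewrite lq_norm0 ltry].
- by move=> T [[]].
move=> S T1 T2 c c0 Sl [[T1l T1f] T1b] [[T2l T2f] T2b] le; split.
  split => // x; apply: (le_lt_trans (le x)).
  by rewrite lte_mul_pinfty ?lee_fin// lte_add_pinfty.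
apply: (@le_lt_trans _ _ (c%:E * (op_norm q T1 + op_norm q T2))%E); last first.
  by rewrite lte_mul_pinfty ?lee_fin// lte_add_pinfty.
apply: ge_ereal_sup => _ [x x1 <-]; apply: (le_trans (le x)).
apply: lee_wpmul2l; first by rewrite lee_fin.
by apply: leeD; apply: ereal_sup_ubound; exists x.
Qed.

Lemma op_norm_bounded_evaluations : bounded_evaluations (op_norm q).
Proof.
move=> x n; have [d [y [y1 Ty]]] := exists_unit_rescaling x.
exists (rnorm (d : K^o)); split; first exact: rnorm_ge0.
move=> T e Tl Te; rewrite Ty// rnormM; apply: ler_wpM2l; first exact: rnorm_ge0.
rewrite -lee_fin; apply: (le_trans (lq_norm_ge q0 _ _)); apply: le_trans (ltW Te).
by apply: ereal_sup_ubound; exists y.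
Qed.

(** * Summing operators as an ideal with continuous evaluations *)

Section Summing.
Variables (Lambda : set (m.-tuple nat)) (r s : m.-tuple R).
Hypotheses (r1 : forall k, 1 <= tnth r k) (s1 : forall k, 1 <= tnth s k).
Hypothesis Lambda0 : Lambda (nseq_tuple m 0%N).

Lemma tnth_gt0 k : 0 < tnth r k.
Proof. exact: lt_le_trans (r1 k). Qed.

Lemma weak_norm_ge0 (F : normedModType K) (p : R) N (x : nat -> F) :
  (0 <= weak_norm p N x)%E.
Proof.
pose phi : {linear F -> K^o} := [the {linear F -> K^o} of (\0 : F -> K^o)].
apply: (@le_trans _ _ ((\sum_(i < N) rnorm (phi (x i)) `^ p) `^ p^-1)%:E).
  by rewrite lee_fin powR_ge0.
apply: ereal_sup_ubound; exists phi => //; split.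
  exact: cst_continuous.
by move=> y _; rewrite /= rnorm0.
Qed.

(** For one vector the weak norm is the supremum of $|\phi(v)|$; writing $v = c\,(c^{-1}v)$ with
    $c^{-1}v$ in the unit ball bounds it by $|c|$, whatever [p] is. *)
Lemma weak_norm1_le (F : normedModType K) (v : F) : exists D : R,
  0 <= D /\ forall p, 0 < p ->
    (weak_norm p 1 (fun i => if i == 0%N then v else 0%R) <= D%:E)%E.
Proof.
have [c [c0 c1]] := exists_rescaling v.
exists (rnorm (c : K^o)); split; first exact: rnorm_ge0.
move=> p p0; apply: ge_ereal_sup => _ [phi [_ phi1] <-].
rewrite lee_fin big_ord1/= -powRrM divff ?gt_eqF// powRr1 ?rnorm_ge0//.
rewrite -[v]scale1r -(mulfV c0) -scalerA linearZ rnormZ ler_piMr ?rnorm_ge0//.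
exact: phi1.
Qed.

Let summand_ge0 T (x : forall k, nat -> E k) (i : m.-tuple nat) :
  (0 <= if i \in Lambda then lq_norm q (T (fun k => x k (tnth i k))) else 0)%E.
Proof. by case: ifP => // _; exact: lq_norm_ge0. Qed.

(** The summing inequality is tested with $N = 1$, each sequence having [x k] as its only term. The
    mixed norm dominates the summand at the constant multi-index 0, which belongs to [Lambda]. *)
Lemma summing_norm_bounded_evaluations :
  bounded_evaluations (summing_norm Lambda r s q).
Proof.
move=> x n.
have /choice[D HD] : forall k : 'I_m, exists D : R, 0 <= D /\ forall p, 0 < p ->
    (weak_norm p 1 (fun i => if i == 0%N then x k else 0%R) <= D%:E)%E.
  by move=> k; exact: weak_norm1_le.
exists (\prod_(k < m) D k); split; first by apply: prodr_ge0 => k _; exact: (HD k).1.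
move=> T e Tl /ereal_inf_lt[_ [C [C0 HC] <-]]; rewrite lte_fin => Ce.
pose xx k i := if i == 0%N then x k else 0.
have xx0 k i : (1 <= i)%N -> xx k i = 0 by case: i.
have le := HC 1%N xx isT xx0.
apply: (@le_trans _ _ (C * \prod_(k < m) D k)); last first.
  rewrite mulrC; apply: ler_wpM2l; last exact: ltW.
  by apply: prodr_ge0 => k _; exact: (HD k).1.
rewrite -lee_fin; apply: le_trans (_ : C%:E * \prod_(k < m) (D k)%:E <= _)%E; last first.
  by rewrite EFinM prodEFin.
apply: le_trans (le_trans le _); last first.
  apply: lee_wpmul2l; first by rewrite lee_fin ltW.
  (* Nonnegativity is carried through the induction, since multiplying the inequalities requires
     it. *)
  have : (0 <= \prod_(k < m) weak_norm (tnth s k) 1 (fun i => if i == 0%N then x k else 0%R)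
      <= \prod_(k < m) (D k)%:E)%E; last by case/andP.
  elim/big_rec2: _ => [|k a b _ /andP[b0 ba]]; first by rewrite lexx lee_fin ler01.
  rewrite mule_ge0 ?weak_norm_ge0//=; apply: lee_pmul => //; first exact: weak_norm_ge0.
  by apply: (HD k).2; exact: lt_le_trans (s1 k).
apply: le_trans (mixed_norm_ge (nseq_tuple m 0%N) tnth_gt0 _); last exact: summand_ge0.
rewrite ifT; last by rewrite inE.
rewrite (_ : (fun k => _) = x); last first.
  by apply: functional_extensionality_dep => k; rewrite tnth_nseq.
exact: lq_norm_ge.
Qed.

Lemma summing_ops_ideal : operator_ideal (summing_ops E Lambda r s q).
Proof.
have P0 N (x : forall k, nat -> E k) : (0 <= \prod_(k < m) weak_norm (tnth s k) N (x k))%E.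
  by apply: prode_ge0 => k _; exact: weak_norm_ge0.
have [M [M0 HM]] := mixed_normD tnth_gt0.
split.
- split; first by split; [exact: multilinear0|move=> x; rewrite lq_norm0 ltry].
  exists 1; split => // N x _ _; rewrite mul1e.
  (* Written as a multiple by 0, the zero family has mixed norm 0 by homogeneity. *)
  rewrite (_ : (fun i => _) = fun i => (0%:E * 0)%E); last first.
    by apply/funext => i; rewrite mul0e lq_norm0; case: ifP.
  by rewrite (mixed_normZ tnth_gt0)// mul0e.
- by move=> T [[]].
move=> S T1 T2 c c0 Sl [[T1l T1f] [C1 [C10 HC1]]] [[T2l T2f] [C2 [C20 HC2]]] le; split.
  split => // x; apply: (le_lt_trans (le x)).
  by rewrite lte_mul_pinfty ?lee_fin// lte_add_pinfty.
(* [c] comes from the domination and [M] from the quasi-triangle inequality of the mixed norm;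
   adding 1 keeps the constant positive even if [c] is 0. *)
exists (c * M * (C1 + C2) + 1); split.
  by rewrite ltr_wpDl// !mulr_ge0// addr_ge0// ltW.
move=> N x N0 xN; have {}HC1 := HC1 N x N0 xN; have {}HC2 := HC2 N x N0 xN.
set P := (\prod_(k < m) _)%E in HC1 HC2 *.
set F1 := (X in mixed_norm r X) in HC1; set F2 := (X in mixed_norm r X) in HC2.
apply: (@le_trans _ _ (mixed_norm r (fun i => c%:E * (F1 i + F2 i))%E)).
  apply: le_mixed_norm => [||i]; [exact: tnth_gt0|exact: (summand_ge0 S x)|].
  by rewrite /F1 /F2; case: ifP => // _; rewrite adde0 mule0.
rewrite (mixed_normZ tnth_gt0)//; last first.
  by move=> i; rewrite adde_ge0// ?(summand_ge0 T1 x) ?(summand_ge0 T2 x).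
apply: (@le_trans _ _ ((c * M * (C1 + C2))%:E * P)%E); last first.
  by apply: lee_wpmul2r; [exact: P0|rewrite lee_fin lerDl].
rewrite -mulrA EFinM -muleA; apply: lee_wpmul2l; first by rewrite lee_fin.
apply: (le_trans (HM _ _ (summand_ge0 T1 x) (summand_ge0 T2 x))).
rewrite EFinM -muleA; apply: lee_wpmul2l; first by rewrite lee_fin.
by rewrite EFinD ge0_muleDl; [exact: leeD|rewrite lee_fin ltW|rewrite lee_fin ltW].
Qed.

End Summing.

End OperatorIdeals.

(** * Spaceability of the difference of two ideals *)

Section Spaceability.
Variables (R : realType) (kind : scalar_kind) (m : nat).
Local Notation K := (scalars R kind).
Variables (E : 'I_m -> completeNormedModType K) (q : \bar R).
Hypothesis q0 : (0 < q)%E.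
Local Notation V := (op_to_seq E).
Implicit Types (S T : V) (X Y : set V).

(** What survives is the part on the class $M$ of parity other than [b], exactly where every
    [spread b] vanishes. *)
Definition drop_parity (b : bool) (x : nat -> K^o) : nat -> K^o :=
  fun n => if odd n == b then 0 else x n.

Lemma drop_parity_linear b (c : K) (x y : nat -> K^o) :
  drop_parity b (c *: x + y) = c *: drop_parity b x + drop_parity b y.
Proof.
apply/funext => n; rewrite /drop_parity !fctE; case: ifP => // _.
by rewrite scaler0 addr0.
Qed.

Lemma drop_parity_le b (x : nat -> K^o) n : rnorm (drop_parity b x n) <= rnorm (x n).
Proof. by rewrite /drop_parity; case: ifP => // _; rewrite rnorm0 rnorm_ge0. Qed.

Lemma drop_parity_sum (x : nat -> K^o) :
  x = (drop_parity true x : nat -> K^o) + drop_parity false x.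
Proof.
apply/funext => n; rewrite /drop_parity !fctE.
by case: (odd n); rewrite /= ?add0r ?addr0.
Qed.

(** [T] is the sum of its two halves, so by the quasi-triangle inequality it would be dominated by
    two members of [Y] if both halves were in [Y]. *)
Lemma exists_parity_notin Y T : operator_ideal q Y -> multilinear_map T -> ~ Y T ->
  exists b, ~ Y (fun x => drop_parity b (T x)).
Proof.
move=> [_ _ YY] Tl YT; apply: contrapT => H; apply: YT.
have HY b : Y (fun x => drop_parity b (T x)).
  by apply: contrapT => HN; apply: H; exists b.
apply: (YY _ _ _ (lq_const q) _ _ (HY true) (HY false)) => //.
  exact: lq_const_ge0.
by move=> x; rewrite {1}(drop_parity_sum (T x)); exact: lq_normD.
Qed.

(** * The closed subspace attached to one operator *)

Section Construction.
Variables (X Y : set V) (nu : V -> \bar R) (T : V) (b : bool).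
Hypotheses (XI : operator_ideal q X) (YI : operator_ideal q Y).
Hypothesis nuE : bounded_evaluations nu.
Hypotheses (XT : X T) (YbT : ~ Y (fun x => drop_parity b (T x))).
Variables (x0 : forall k, E k) (n0 : nat).
Hypotheses (n0b : odd n0 != b) (T0 : T x0 n0 != 0).

Definition spread_op (c : K) (a : nat -> K) : V :=
  fun x => c *: (T x : nat -> K^o) + spread b a (T x).

(** The weights are arbitrary, so the values of [spread_op c a] may leave $\ell_q$; membership in
    [X] is therefore imposed separately. *)
Definition spread_space : set V := [set S | X S /\ exists c a, S = spread_op c a].

(** Recovers $c$: the coordinate [n0] lies in $M$, where the spread part vanishes. *)
Definition coef_id S : K := S x0 n0 / T x0 n0.

(** Recovers $a_j$: once the contribution of $cT$ is removed, the coordinate of $N_j$ coded by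
    [(n0, j)] holds $a_j$ times [T x0 n0]. *)
Definition coef_spread S (j : nat) : K :=
  (S x0 (pair_code b (n0, j)) - coef_id S * T x0 (pair_code b (n0, j))) / T x0 n0.

Let Tl : multilinear_map T. Proof. by case: XI => _ + _; exact. Qed.

Let Xl : linear_subspace X. Proof. exact: (operator_ideal_subspace q0 XI). Qed.

Lemma spread_opE c a x n : spread_op c a x n = c * T x n + spread b a (T x) n.
Proof. by []. Qed.

Lemma coef_id_spread_op c a : coef_id (spread_op c a) = c.
Proof. by rewrite /coef_id spread_opE spread_odd// addr0 mulfK. Qed.

Lemma coef_spread_spread_op c a : coef_spread (spread_op c a) = a.
Proof.
apply/funext => j; rewrite /coef_spread coef_id_spread_op spread_opE spread_pair_code.
by rewrite addrC addKr mulfK.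
Qed.

Lemma spread_op_comb (d c c' : K) (a a' : nat -> K) :
  d *: spread_op c a + spread_op c' a' = spread_op (d * c + c') (fun j => d * a j + a' j).
Proof.
apply/funext => x; apply/funext => n.
change (d * spread_op c a x n + spread_op c' a' x n =
  spread_op (d * c + c') (fun j => d * a j + a' j) x n).
rewrite !spread_opE spread_linearl.
change (d * (c * T x n + spread b a (T x) n) + (c' * T x n + spread b a' (T x) n) =
  (d * c + c') * T x n + (d * spread b a (T x) n + spread b a' (T x) n)).
ring.
Qed.

Lemma spread_op00 : spread_op 0 (fun=> 0) = 0.
Proof.
have := spread_op_comb (-1) 0 0 (fun=> 0) (fun=> 0).
rewrite mulr0 addr0 scaleN1r addNr => ->.
by congr spread_op; apply/funext => j; rewrite mulr0 addr0.
Qed.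

Lemma spread_op_multilinear c a : multilinear_map (spread_op c a).
Proof.
apply: (@multilinear_comb _ _ _ _ c T (fun x => spread b a (T x))) => //.
by apply: (@multilinear_comp _ _ _ _ (spread b a)) => // *; exact: spread_linear.
Qed.

Lemma spread_space_subspace : linear_subspace spread_space.
Proof.
split.
  by split; [exact: Xl.1|exists 0, (fun=> 0); rewrite spread_op00].
move=> d S S' [XS [c [a SE]]] [XS' [c' [a' SE']]]; split; first exact: Xl.2.
by exists (d * c + c'), (fun j => d * a j + a' j); rewrite SE SE' spread_op_comb.
Qed.

Lemma spread_space_op : spread_space T.
Proof.
split=> //; exists 1, (fun=> 0); apply/funext => x; apply/funext => n.
rewrite spread_opE mul1r /spread; case: ifP; last by rewrite addr0.
by case: pickle_inv => [kj|] _; rewrite ?mul0r addr0.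
Qed.

(* Membership in [spread_space] is cut out by linear equations, each of which
   involves at most three evaluations. *)
Lemma spread_defect x n : exists (u v : K) (n1 : nat), forall S,
  S x n - spread_op (coef_id S) (coef_spread S) x n =
  S x n - u * S x0 n0 - v * S x0 n1.
Proof.
have [[[k j] <-]|ne] := pselect (exists kj, pair_code b kj = n).
  exists ((T x (pair_code b (k, j)) - T x0 (pair_code b (n0, j)) / T x0 n0 * T x k) / T x0 n0),
    (T x k / T x0 n0), (pair_code b (n0, j)) => S.
  have solve (F : fieldType) (w t w0 t0 w1 t1 tk : F) : t0 != 0 ->
      w - (w0 / t0 * t + (w1 - w0 / t0 * t1) / t0 * tk) =
      w - (t - t1 / t0 * tk) / t0 * w0 - tk / t0 * w1 by move=> ?; field.
  by rewrite spread_opE spread_pair_code; exact: solve.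
(* Off the codes the spread part is 0, so only [coef_id] enters; with [v] equal to 0 the choice of
   [n1] is arbitrary. *)
exists (T x n / T x0 n0), 0, 0%N => S.
rewrite spread_opE spread_out; last by move=> kj kjn; apply: ne; exists kj.
by rewrite addr0 mul0r subr0 /coef_id mulrAC [T x n / _ * _]mulrAC [T x n * _]mulrC.
Qed.

(** An operator outside the space has a nonzero defect at some coordinate. This defect is a bounded
    functional vanishing on the space, so a whole ball avoids the space. *)
Lemma spread_space_closed : quasinorm_closed X nu spread_space.
Proof.
split; first by move=> S [].
split; first by move=> S [].
move=> S [XS SW].
have [x [n Sxn]] : exists x n, S x n - spread_op (coef_id S) (coef_spread S) x n != 0.
  apply: contrapT => H; apply: SW; split => //.
  exists (coef_id S), (coef_spread S); apply/funext => x; apply/funext => n.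
  apply/eqP; rewrite -subr_eq0; apply: contrapT => /negP Hn.
  by apply: H; exists x, n.
have [u [v [n1 uv]]] := spread_defect x n; rewrite uv in Sxn.
have [D1 [D10 HD1]] := nuE x n.
have [D2 [D20 HD2]] := nuE x0 n0.
have [D3 [D30 HD3]] := nuE x0 n1.
pose g S' : K^o := S' x n - u * S' x0 n0 - v * S' x0 n1.
(* [D - 1] bounds the functional [g]; the extra 1 makes the final estimate strict, $(D-1)|g(S)|/D <
   |g(S)|$. *)
pose D := D1 + rnorm (u : K^o) * D2 + rnorm (v : K^o) * D3 + 1.
have D0 : 0 < D by rewrite ltr_wpDl// !addr_ge0// mulr_ge0// rnorm_ge0.
have gS0 : 0 < rnorm (g S).
  rewrite lt_neqAle rnorm_ge0 andbT eq_sym; apply/eqP => /rnorm_eq0 gS.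
  by move/eqP: Sxn; apply.
exists (rnorm (g S) / D); split; first by rewrite divr_gt0.
move=> S' XS' nuS; split => // -[_ [c [a S'E]]].
have gS' : g S' = 0.
  by rewrite /g -uv S'E coef_id_spread_op coef_spread_spread_op subrr.
have dl : multilinear_map (S' - S : V).
  have [_ XM _] := XI; rewrite addrC -scaleN1r.
  by apply: multilinear_comb; exact: XM.
have gd : g (S' - S) = - g S.
  have -> : g (S' - S) = g S' - g S by rewrite /g !fctE; ring.
  by rewrite gS' sub0r.
have e0 : 0 < rnorm (g S) / D by rewrite divr_gt0.
have rN (z : K^o) : rnorm (- z) = rnorm z by rewrite /rnorm normrN.
have : rnorm (g (S' - S)) <= (D - 1) * (rnorm (g S) / D).
  rewrite /g; apply: (le_trans (rnormD _ _)); rewrite rN.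
  apply: (le_trans (lerD (rnormD _ _) (lexx _))); rewrite rN !rnormM.
  rewrite /D addrK !mulrDl -!mulrA; apply: lerD; first apply: lerD.
  - exact: HD1.
  - by apply: ler_wpM2l; [exact: rnorm_ge0|exact: HD2].
  - by apply: ler_wpM2l; [exact: rnorm_ge0|exact: HD3].
rewrite gd rN mulrBl mul1r mulrCA divff ?gt_eqF// mulr1 leNgt => /negP; apply.
by rewrite ltrBlDr ltrDl.
Qed.

Lemma spread_space_avoids : spread_space `<=` (X `\` Y) `|` [set 0].
Proof.
move=> S [XS [c [a SE]]].
have [YS|YS] := pselect (Y S); last by left.
right; rewrite SE.
have [c0|c0] := eqVneq c 0; last first.
  (* For nonzero [c], dropping parity [b] from [S] leaves $c$ times the half of [T] that is not in
     [Y]. *)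
  case: YbT; apply: (operator_ideal_dominated q0 YI (rnorm_ge0 (c^-1 : K^o)) _ YS).
    by apply: multilinear_comp => //; exact: drop_parity_linear.
  move=> x; rewrite (_ : drop_parity b (T x) = c^-1 *: (drop_parity b (S x) : nat -> K^o)).
    apply: (le_trans (lq_normZ q0 _ _)); apply: lee_wpmul2l.
      by rewrite lee_fin rnorm_ge0.
    by apply: le_lq_norm => // n; exact: drop_parity_le.
  apply/funext => n; change (drop_parity b (T x) n = c^-1 * drop_parity b (S x) n).
  rewrite SE /drop_parity; case: ifPn => [_|bn]; first by rewrite mulr0.
  by rewrite spread_opE spread_odd// addr0 mulrA mulVf// mul1r.
have [[j aj]|a0] := pselect (exists j, a j != 0); last first.
  rewrite c0 (_ : a = fun=> 0) ?spread_op00//=.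
  by apply/funext => j; apply/eqP/negP => /negP aj; apply: a0; exists j.
(* For zero [c], reading [S] along $N_j$ gives $a_j T$, so [T] itself would be in [Y], and with it
   its half. *)
have YT : Y T.
  apply: (operator_ideal_dominated q0 YI (rnorm_ge0 ((a j)^-1 : K^o)) Tl YS) => x.
  pose h k := pair_code b (k, j).
  have hI : injective h by move=> k l /pair_code_inj [].
  rewrite (_ : T x = (a j)^-1 *: (S x \o h : nat -> K^o)).
    apply: (le_trans (lq_normZ q0 _ _)); apply: lee_wpmul2l.
      by rewrite lee_fin rnorm_ge0.
    exact: lq_norm_comp_le.
  apply/funext => k; change (T x k = (a j)^-1 * S x (pair_code b (k, j))).
  by rewrite SE c0 spread_opE mul0r add0r spread_pair_code mulrA mulVf// mul1r.
case: YbT; apply: (operator_ideal_dominated q0 YI ler01 _ YT).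
  by apply: multilinear_comp => //; exact: drop_parity_linear.
by move=> x; rewrite mul1e; apply: le_lq_norm => // n; exact: drop_parity_le.
Qed.

Definition geometric_op (l : R) : V := spread_op 0 (fun j => real_scalar kind l ^+ j).

Lemma geometric_op_inj : injective geometric_op.
Proof.
move=> l l' /(congr1 coef_spread).
rewrite !coef_spread_spread_op => /(congr1 (fun a => a 1%N)).
by rewrite !expr1 => /real_scalar_inj.
Qed.

(** Geometric weights lie in every $\ell_q$, so the operator is dominated by a multiple of [T]. *)
Lemma geometric_op_in l : 0 < l < 1 -> spread_space (geometric_op l).
Proof.
move=> l01; split; last by exists 0, (fun j => real_scalar kind l ^+ j).
have zl : rnorm (real_scalar kind l : (scalars R kind)^o) = l.
  by rewrite rnorm_real_scalar// ltW//; case/andP: l01.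
have [|C [C0 HC]] := @lq_norm_spread R kind q b (real_scalar kind l) q0.
  by rewrite zl.
apply: (operator_ideal_dominated q0 XI C0 _ XT); first exact: spread_op_multilinear.
move=> x; apply: le_trans (HC (T x)); rewrite /geometric_op /spread_op.
by rewrite scale0r add0r.
Qed.

Lemma eval_sum (s : seq V) (c : V -> K) x n :
  (\sum_(v <- s) c v *: v) x n = \sum_(v <- s) c v * v x n.
Proof.
elim: s => [|v s IH]; first by rewrite !big_nil.
by rewrite !big_cons -IH.
Qed.

(* Reading the coordinates [pair_code b (n0, j)] turns a linear relation between
   geometric operators into the vanishing of all power sums of their ratios,
   hence of [\sum c_v p(z_v)] for every polynomial [p]. *)
Lemma geometric_op_independent :
  linearly_independent (geometric_op @` [set l | 0 < l < 1]).
Proof.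
move=> s c us sA s0 v vs.
pose z (w : V) : K := coef_spread w 1%N.
have wE w : w \in s -> exists2 l, w = geometric_op l & z w = real_scalar kind l.
  by move=> /sA[l _ <-]; exists l => //; rewrite /z coef_spread_spread_op expr1.
have pow j : \sum_(w <- s) c w * z w ^+ j = 0.
  apply: (mulIf T0); rewrite mul0r mulr_suml.
  have := congr1 (fun S : V => S x0 (pair_code b (n0, j))) s0; rewrite /= eval_sum.
  rewrite [X in _ = X -> _](_ : _ = 0)// => {2}<-.
  rewrite big_seq [RHS]big_seq; apply: eq_bigr => w /wE[l -> ->].
  by rewrite /geometric_op spread_opE mul0r add0r spread_pair_code mulrA.
have polE (p : {poly K}) : \sum_(w <- s) c w * p.[z w] = 0.
  under eq_bigr do rewrite horner_coef mulr_sumr.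
  rewrite exchange_big big1// => i _.
  by under eq_bigr do rewrite mulrCA; rewrite -mulr_sumr pow mulr0.
(* This polynomial vanishes at the ratio of every vector of the relation except possibly [v],
   isolating the coefficient of [v]. *)
have := polE (\prod_(w <- rem v s) ('X - (z w)%:P)).
rewrite (perm_big _ (perm_to_rem vs)) big_cons /=.
rewrite [X in _ + X]big_seq [X in _ + X]big1 ?addr0; last first.
  move=> w ws; rewrite horner_prod (perm_big _ (perm_to_rem ws)) big_cons /=.
  by rewrite hornerXsubC subrr mul0r mulr0.
move/eqP; rewrite mulf_eq0 => /orP[/eqP//|].
rewrite horner_prod prodf_seq_eq0 => /hasP[w]; rewrite mem_rem_uniq// !inE.
move=> /andP[wv ws]; rewrite hornerXsubC subr_eq0 => /eqP zvw.
have [l wl zl] := wE _ ws; have [l' vl' zl'] := wE _ vs.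
by move: wv; rewrite wl vl'; move: zvw; rewrite zl zl' => /real_scalar_inj ->; rewrite eqxx.
Qed.

(** From below, a Hamel basis is chosen to contain the geometric operators. From above, an element
    is determined by [c] and [a], packed as one scalar function on [option nat] with [c] at
    [None]. *)
Lemma spread_space_dim : has_dim spread_space [set: R].
Proof.
have AW : geometric_op @` [set l | 0 < l < 1] `<=` spread_space.
  by move=> _ [l l01 <-]; exact: geometric_op_in.
have [B [AB BW]] := hamel_basis_extension spread_space_subspace AW geometric_op_independent.
exists B; split => //; apply: Cantor_Bernstein; last first.
  apply: card_le_trans (subset_card_le AB); apply: card_le_trans (card_itv01 R) _.
  apply: (card_le_inj (f := geometric_op)) => [l l01|l l' _ _]; first by exists l.
  exact: geometric_op_inj.
apply: card_le_trans (card_scalar_fun R kind (option nat)).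
apply: (card_le_inj (f := fun S i => if i is Some j then coef_spread S j else coef_id S)) => //.
have BsubW : B `<=` spread_space.
  move=> v Bv; rewrite -BW.2; exists [:: v], (fun=> 1); split.
    by move=> w; rewrite inE => /eqP ->.
  by rewrite big_seq1 scale1r.
move=> S S'; rewrite !inE => /BsubW[_ [c [a ->]]] /BsubW[_ [c' [a' ->]]] SS'.
have := congr1 (fun f => f None) SS'; rewrite /= !coef_id_spread_op => ->.
congr spread_op; apply/funext => j.
by have := congr1 (fun f => f (Some j)) SS'; rewrite /= !coef_spread_spread_op.
Qed.

End Construction.

(** The right alternative always holds, vacuously when the difference is empty. *)
Lemma ideal_difference_spaceable X Y (nu : V -> \bar R) :
  operator_ideal q X -> operator_ideal q Y -> bounded_evaluations nu ->
  empty_or_spaceable X nu (X `\` Y).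
Proof.
move=> XI YI nuE; right; split; first by move=> T [].
move=> T [XT YT]; have [_ Xlin _] := XI.
have [b YbT] := exists_parity_notin YI (Xlin _ XT) YT.
(* If [T] vanished at all coordinates of parity other than [b], its half there would be 0, which is
   in [Y]. *)
have [x0 [n0 [n0b T0]]] : exists x0 n0, odd n0 != b /\ T x0 n0 != 0.
  apply: contrapT => H; apply: YbT; have [Y0 _ _] := YI.
  rewrite (_ : (fun x => _) = 0)//; apply/funext => x; apply/funext => n.
  rewrite /drop_parity; case: ifPn => // bn; apply/eqP; apply: contrapT => /negP Tn.
  by apply: H; exists x, n.
exists (spread_space X T b); split.
- exact: spread_space_subspace.
- exact: (spread_space_closed XI nuE n0b T0).
- exact: (spread_space_dim XI XT n0b T0).
- exact: spread_space_op.
- exact: (spread_space_avoids XI YI XT YbT).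
Qed.

End Spaceability.

(** * The three differences of operator classes *)

Unset Implicit Arguments.

Theorem corollary3p3 (R : realType) (kind : scalar_kind) (m : nat)
    (hm : (0 < m)%N) (E : 'I_m -> completeNormedModType (scalars R kind))
    (q : \bar R) (hq : (0 < q)%E) (r s t u : m.-tuple R)
    (hr : forall k, 1 <= tnth r k) (hs : forall k, 1 <= tnth s k)
    (ht : forall k, 1 <= tnth t k) (hu : forall k, 1 <= tnth u k) :
  [/\ empty_or_spaceable (bounded_ops E q) (op_norm q)
        (bounded_ops E q `\` multiple_summing E t u q),
      empty_or_spaceable (bounded_ops E q) (op_norm q)
        (bounded_ops E q `\` absolutely_summing E t u q)
    & empty_or_spaceable (absolutely_summing E r s q)
        (absolutely_summing_norm r s q)
        (absolutely_summing E r s q `\` multiple_summing E t u q)].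
Proof.
split; apply: (ideal_difference_spaceable hq).
- exact: bounded_ops_ideal.
- exact: summing_ops_ideal.
- exact: op_norm_bounded_evaluations.
- exact: bounded_ops_ideal.
- exact: summing_ops_ideal.
- exact: op_norm_bounded_evaluations.
- exact: summing_ops_ideal.
- exact: summing_ops_ideal.
(* The diagonal contains the constant multi-index 0 used to test the summing inequality. *)
- by apply: summing_norm_bounded_evaluations => //; exists 0%N.
Qed.
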